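(* Let $m\ge 4$ be even, $n=2^m-1$, and let $i_1\neq i_2$ in $\{0,1,2,3\}$ be such that the extended code $\mathcal{C}^*_{i_1,i_2}$ of $\mathcal{C}_{i_1,i_2}$ is an $[n+1,n-m-1,4]$ code of length $n+1=2^m$. Then $\mathcal{C}^*_{i_1,i_2}$ is completely transitive with covering radius $\rho=4$ and intersection array $\bigl(n+1,n,\tfrac{n+1}{2},1;\,1,\tfrac{n+1}{2},n,n+1\bigr)$ if and only if $0\notin\{i_1,i_2\}$.
   Context: $\mathbb{F}_2$ is the binary field. Let $\alpha$ be a primitive element of $GF(2^m)$ and let $H_m$ be the $m\times n$ binary matrix whose $i$-th column $\mathbf{h}_i$ ($i=0,\dots,n-1$) is the coordinate vector of $\alpha^i$ with respect to the basis $1,\alpha,\dots,\alpha^{m-1}$ (so the columns are exactly the nonzero vectors of $\mathbb{F}_2^m$; $H_m$ is a parity check matrix of the Hamming code). For distinct $i_1,i_2\in\{0,1,2,3\}$, $\mathbf{v}_{i_1,i_2}=(v_0,\dots,v_{n-1})$ has $v_i=1$ iff the Hamming weight $\mathrm{wt}(\mathbf{h}_i)\equiv i_1$ or $i_2\pmod 4$; $\mathcal{C}_{i_1,i_2}$ is the code with parity check matrix $H_m$ with the row $\mathbf{v}_{i_1,i_2}$ appended. The extension of a code $C$ of length $n$ is $C^*=\{(c_\infty,c_0,\dots,c_{n-1}):(c_0,\dots,c_{n-1})\in C,\ c_\infty=\sum_i c_i\}$. For a binary linear code $C$ of length $N$: $d(\mathbf{v},C)$ is the minimum Hamming distance from $\mathbf{v}$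 to $C$, the covering radius is $\rho=\max_{\mathbf{v}}d(\mathbf{v},C)$, and $C(l)=\{\mathbf{x}:d(\mathbf{x},C)=l\}$. $C$ is completely regular if for each $l$ every $\mathbf{x}\in C(l)$ has the same number $c_l$ of neighbors (vectors at distance 1) in $C(l-1)$ and the same number $b_l$ in $C(l+1)$; the intersection array is $(b_0,\dots,b_{\rho-1};c_1,\dots,c_\rho)$. $\mathrm{Aut}(C)$ is the group of coordinate permutations preserving $C$, acting on cosets via $\pi(C+\mathbf{v})=C+\pi(\mathbf{v})$; $C$ is completely transitive if $\mathrm{Aut}(C)$ has exactly $\rho+1$ orbits on the cosets of $C$. *)

(* Defs.v *)
From HB Require Import structures.
From mathcomp Require Import all_boot all_order all_algebra all_fingroup all_field.

Set Implicit Arguments.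
Unset Strict Implicit.
Unset Printing Implicit Defensive.

Import GRing.Theory.
Local Open Scope ring_scope.

Section Codes.
Variable N : nat.
Implicit Types (x y : 'rV['F_2]_N) (C : {vspace 'rV['F_2]_N}).

Definition wt x : nat := #|[set i | x 0 i != 0]|.

Definition hdist x y : nat := #|[set i | x 0 i != y 0 i]|.

(* All distances are at most N and C is nonempty, so the default value N
   does not affect the minimum. *)
Definition dist_code x C : nat := \big[minn/N]_(c | c \in C) hdist x c.

Definition covering_radius C : nat := \max_x dist_code x C.

Definition is_min_dist C (d : nat) : Prop :=
  (exists x y, [/\ x \in C, y \in C, x != y & hdist x y = d]) /\
  (forall x y, x \in C -> y \in C -> x != y -> (d <= hdist x y)%N).

(* C is an [N, k, d] code. *)
Definition code_params C (k d : nat) : Prop := \dim C = k /\ is_min_dist C d.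

(* Neighbors of x in C(l - 1), resp. in C(l + 1), where x belongs to C(l);
   C(-1) is empty. *)
Definition lower_nbrs C x : {set 'rV['F_2]_N} :=
  [set y | (hdist x y == 1%N) && ((dist_code y C).+1 == dist_code x C)].

Definition upper_nbrs C x : {set 'rV['F_2]_N} :=
  [set y | (hdist x y == 1%N) && (dist_code y C == (dist_code x C).+1)].

Definition completely_regular_with C (b c : nat -> nat) : Prop :=
  forall x, #|upper_nbrs C x| = b (dist_code x C) /\
            #|lower_nbrs C x| = c (dist_code x C).

Definition completely_regular C : Prop :=
  exists b c : nat -> nat, completely_regular_with C b c.

(* bs = (b_0, ..., b_(rho - 1)) and cs = (c_1, ..., c_rho). *)
Definition is_intersection_array C (bs cs : seq nat) : Prop :=
  exists b c : nat -> nat,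
    [/\ completely_regular_with C b c,
        bs = map b (iota 0 (covering_radius C))
      & cs = map c (iota 1 (covering_radius C))].

(* pi(v)_(pi i) = v_i; the inverse makes this a right action. *)
Definition perm_word x (s : 'S_N) : 'rV['F_2]_N := col_perm s^-1%g x.

Fact perm_word1 : perm_word^~ 1%g =1 id.
Proof. by move=> x; rewrite /perm_word invg1 col_perm1. Qed.

Fact perm_wordM : forall x, act_morph perm_word x.
Proof. by move=> x s t; rewrite /perm_word invMg col_permM. Qed.

Canonical perm_word_action := TotalAction perm_word1 perm_wordM.

Definition code_aut C : {set 'S_N} := 'N([set x in C] | perm_word_action)%g.

Definition code_coset C x : {set 'rV['F_2]_N} := [set x + c | c in C].

(* Since Aut(C) preserves C, it maps the coset C + v, as a set, to C + pi(v). *)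
Definition coset_orbits C : {set {set {set 'rV['F_2]_N}}} :=
  [set orbit (perm_word_action^*)%act (code_aut C) (code_coset C x)
     | x : 'rV['F_2]_N].

Definition completely_transitive C : Prop :=
  #|coset_orbits C| = (covering_radius C).+1.

Definition parity_check_code k (P : 'M['F_2]_(k, N)) : {vspace 'rV['F_2]_N} :=
  lker (linfun (mulmxr P^T : 'rV_N -> 'rV_k)).

Lemma mem_parity_check_code k (P : 'M['F_2]_(k, N)) x :
  (x \in parity_check_code P) = (P *m x^T == 0).
Proof.
by rewrite memv_ker lfunE /= -(inj_eq (@trmx_inj _ _ _)) trmx_mul trmxK trmx0.
Qed.

(* The coordinate at infinity comes first, at index 0. *)
Definition extend_word x : 'rV['F_2]_(1 + N) := row_mx (\sum_i x 0 i)%:M x.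

Fact extend_word_is_linear : linear extend_word.
Proof.
move=> a x y; rewrite /extend_word scale_row_mx add_row_mx; congr row_mx.
apply/matrixP=> i j; rewrite !ord1 !mxE !mulr1n big_distrr -big_split /=.
by apply: eq_bigr => l _; rewrite !mxE.
Qed.

HB.instance Definition _ :=
  GRing.isLinear.Build 'F_2 'rV['F_2]_N 'rV['F_2]_(1 + N) *:%R extend_word
    extend_word_is_linear.

Definition extension C : {vspace 'rV['F_2]_(1 + N)} :=
  (linfun extend_word @: C)%VS.

Lemma mem_extensionP C (z : 'rV['F_2]_(1 + N)) :
  reflect (exists2 x, x \in C & z = extend_word x) (z \in extension C).
Proof.
apply: (iffP memv_imgP) => -[x xC ->]; exists x => //; by rewrite lfunE.
Qed.

End Codes.

Section HammingSubcodes.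
Variables (L : fieldExtType 'F_2) (alpha : L) (m n : nat) (i1 i2 : 'I_4).

Definition power_basis : m.-tuple L := [tuple alpha ^+ i | i < m].

Definition hamming_mx : 'M['F_2]_(m, n) :=
  \matrix_(i < m, j < n) coord power_basis i (alpha ^+ j).

Definition weight_row : 'rV['F_2]_n :=
  \row_j (let w := wt (col j hamming_mx)^T in
          (w == i1 %[mod 4]) || (w == i2 %[mod 4]))%:R.

Definition code_i1i2 : {vspace 'rV['F_2]_n} :=
  parity_check_code (col_mx hamming_mx weight_row).

End HammingSubcodes.

(* Main.v *)
Require Import Defs.
From HB Require Import structures.
From mathcomp Require Import all_boot all_order all_algebra all_fingroup all_field.
From mathcomp Require Import zify.

Set Implicit Arguments.
Unset Strict Implicit.
Unset Printing Implicit Defensive.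

Import GRing.Theory.
Local Open Scope ring_scope.

(** Index the coordinates of the extended code by the vectors v of F_2^m, the coordinate at
infinity being v = 0. A word x is in the code iff its syndrome, the sum of x_v (1, v, f v),
vanishes, where f v tells whether v <> 0 and wt v is i1 or i2 mod 4.

The indicator of the weights i1, i2 mod 4 is an affine function of the two low binary digits
of the weight, and wt (u + v) = wt u + wt v - 2 |u /\ v|; hence it is, up to a constant, a
quadratic form q. Its polar form is 0 if i1 and i2 have the same parity, and otherwise has
matrix J - I, which is nondegenerate because m is even.

If 0 is not in {i1, i2} then f = q, and the dimension of the code excludes {1, 3}, so f is
bent. The distance of a word to the code can then be read off its syndrome (a, s, t), and so
can the intersection numbers. The translations of F_2^m and the symplectic transvections act
on the columns (1, v, f v) through linear maps of the syndromes, hence are automorphisms of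
the code; they are transitive on the syndromes at each given distance.

If 0 is in {i1, i2} then f = q + [v <> 0]. A word supported on 0 and s is at distance 2 from
the code and has 2 or 2^(m-1) + 2 neighbors at distance 1, instead of the 2^(m-1) prescribed
by the intersection array. *)

(** * The binary field *)

Variant F2_spec : 'F_2 -> Prop := F2_zero : F2_spec 0 | F2_one : F2_spec 1.

Lemma F2P (a : 'F_2) : F2_spec a.
Proof.
case: a => [[|[|k]] lt_k2] //.
  by rewrite (_ : Ordinal _ = 0); [left | apply: val_inj].
by rewrite (_ : Ordinal _ = 1); [right | apply: val_inj].
Qed.

Lemma neq_F2 (a b : 'F_2) : (a != b) = (a == b + 1).
Proof. by case: (F2P a); case: (F2P b). Qed.

Lemma natr_odd_F2 k : k%:R = (odd k)%:R :> 'F_2.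
Proof. by rewrite -modn2 Fp_nat_mod. Qed.

Lemma natr_addb_F2 (b c : bool) : (b (+) c)%:R = b%:R + c%:R :> 'F_2.
Proof. by case: b; case: c; apply/eqP. Qed.

Lemma sum_odd_F2 (I : finType) (g : I -> 'F_2) :
  \sum_i g i = (odd #|[set i | g i != 0]|)%:R.
Proof.
rewrite -natr_odd_F2 -sum1_card natr_sum [RHS]big_mkcond /=.
by apply: eq_bigr => i _; rewrite inE; case: (F2P (g i)).
Qed.

Lemma morphD0 (U V : zmodType) (g : U -> V) : {morph g : x y / x + y} -> g 0 = 0.
Proof. by move=> gD; apply: (addrI (g 0)); rewrite -gD !addr0. Qed.

Section F2Modules.
Variable V : lmodType 'F_2.
Implicit Types u v : V.

Lemma addrr_F2 v : v + v = 0.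
Proof. by rewrite -mulr2n -scaler_nat natr_odd_F2 scale0r. Qed.

Lemma oppr_F2 v : - v = v.
Proof. by apply/esym/eqP; rewrite -addr_eq0 addrr_F2. Qed.

Lemma addr_eq0_F2 u v : (u + v == 0) = (u == v).
Proof. by rewrite addr_eq0 oppr_F2. Qed.

Lemma addKr_F2 v : involutive (+%R v).
Proof. by move=> u; rewrite addrA addrr_F2 add0r. Qed.

Lemma addrK_F2 v : involutive (+%R^~ v).
Proof. by move=> u; rewrite -addrA addrr_F2 addr0. Qed.

Lemma morphDZ_F2 (U : lmodType 'F_2) (g : U -> V) (a : 'F_2) (u : U) :
  {morph g : x y / x + y} -> g (a *: u) = a *: g u.
Proof. by move=> gD; case: (F2P a); rewrite ?scale0r ?scale1r // morphD0. Qed.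

End F2Modules.

Lemma card_set_if (T : finType) (P : pred T) (i j l : nat) :
  #|[set v | (if P v then i else j) == l]| =
    ((i == l) * #|[set v | P v]| + (j == l) * #|[set v | ~~ P v]|)%N.
Proof.
rewrite -!sum1_card !big_distrr [LHS]big_mkcond [X in (X + _)%N]big_mkcond.
rewrite [X in (_ + X)%N]big_mkcond -big_split /=.
apply: eq_bigr => v _; rewrite !inE.
by case: (P v); rewrite /= muln1 ?addn0 ?add0n; case: eqP.
Qed.

Lemma card_preim_bij (I T : finType) (h : I -> T) (P : pred T) :
  bijective h -> #|[set k | P (h k)]| = #|[set v | P v]|.
Proof.
move=> h_bij; rewrite -(on_card_preimset (onW_bij _ h_bij)).
by apply: eq_card => k; rewrite !inE.
Qed.

Local Notation "''e_' k" := (delta_mx 0 k : 'rV['F_2]__)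
  (at level 8, k at level 2, format "''e_' k").

(** * Distance to a binary code *)

Section HammingDistance.
Variable N : nat.
Implicit Types (x y : 'rV['F_2]_N) (C : {vspace 'rV['F_2]_N}) (k : 'I_N).

Lemma hdistE x y : hdist x y = wt (x + y).
Proof. by apply: eq_card => i; rewrite !inE mxE -(addr_eq0_F2 (V := ('F_2)^o)). Qed.

Lemma wt0 : wt (0 : 'rV['F_2]_N) = 0%N.
Proof. by apply: eq_card0 => i; rewrite !inE mxE eqxx. Qed.

Lemma wt_eq0 x : (wt x == 0%N) = (x == 0).
Proof.
apply/eqP/eqP => [/eqP|->]; last exact: wt0.
rewrite cards_eq0 => /eqP/setP supp0; apply/rowP=> i.
by have := supp0 i; rewrite !inE mxE => /negbT; rewrite negbK => /eqP.
Qed.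

Lemma wtD_unit x k : wt (x + 'e_k) = if x 0 k == 0 then (wt x).+1 else (wt x).-1.
Proof.
have supp i : ((x + 'e_k) 0 i != 0) = (x 0 i != 0) (+) (i == k).
  by rewrite !mxE eqxx; case: (i == k); case: (F2P (x 0 i)).
have [xk | xk] := eqVneq (x 0 k) 0.
  have <- : #|k |: [set i | x 0 i != 0]| = (wt x).+1 by rewrite cardsU1 inE xk eqxx.
  apply: eq_card => i; rewrite !inE supp.
  by have [->|] := eqVneq i k; rewrite ?xk ?eqxx ?addbF.
rewrite [in RHS]/wt [in RHS](cardsD1 k) inE xk /=.
apply: eq_card => i; rewrite !inE supp.
by have [->|] := eqVneq i k; rewrite ?xk ?addbF.
Qed.

Lemma wt_unit k : wt 'e_k = 1%N.
Proof. by rewrite -['e_k]add0r wtD_unit mxE eqxx wt0. Qed.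

Lemma wt_eq1P x : reflect (exists k, x = 'e_k) (wt x == 1%N).
Proof.
apply: (iffP idP) => [/cards1P[k suppx]|[k ->]]; last by rewrite wt_unit.
exists k; apply/rowP=> i; rewrite mxE eqxx /=.
by have := in_set1 i k; rewrite -suppx inE; case: (F2P (x 0 i)) => /= <-.
Qed.

Lemma hdist_eq1P x y : reflect (exists k, y = x + 'e_k) (hdist x y == 1%N).
Proof.
rewrite hdistE; apply: (iffP (wt_eq1P _)) => -[k e]; exists k.
  by rewrite -e addKr_F2.
by rewrite e addKr_F2.
Qed.

Lemma card_neighbors x (P : pred 'rV['F_2]_N) :
  #|[set y | (hdist x y == 1%N) && P y]| = #|[set k | P (x + 'e_k)]|.
Proof.
rewrite -(card_imset _ (_ : injective (fun k => x + 'e_k))).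
  apply: eq_card => y; rewrite !inE; apply/andP/imsetP => [[/hdist_eq1P[k ->] Pk]|].
    by exists k; rewrite ?inE.
  by case=> k; rewrite inE => Pk ->; split=> //; apply/hdist_eq1P; exists k.
by move=> i j /addrI/rowP/(_ i); rewrite !mxE !eqxx /=; case: eqVneq.
Qed.

Lemma dist_code_le C x c : c \in C -> (dist_code x C <= hdist x c)%N.
Proof.
move=> cC; rewrite /dist_code; elim: (index_enum _) (mem_index_enum c) => //= d r IHr.
rewrite inE big_cons => /predU1P[<-|/IHr le_r]; first by rewrite cC geq_minl.
by case: ifP => // _; rewrite geq_min le_r orbT.
Qed.

Lemma dist_code_attained C x : exists2 c, c \in C & dist_code x C = hdist x c.
Proof.
have: dist_code x C = N \/ exists2 c, c \in C & dist_code x C = hdist x c.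
  rewrite /dist_code; elim/big_ind: _ => [|u v Pu Pv|c cC]; [by left| |by right; exists c].
  by case: (leqP u v) => _.
case=> // distN; exists 0; first exact: mem0v.
by apply/eqP; rewrite eqn_leq dist_code_le ?mem0v //= distN -[leqRHS]card_ord max_card.
Qed.

Lemma dist_code_leP C x l :
  reflect (exists2 c, c \in C & (hdist x c <= l)%N) (dist_code x C <= l)%N.
Proof.
apply: (iffP idP) => [|[c cC]]; last by apply: leq_trans; apply: dist_code_le.
by have [c cC ->] := dist_code_attained C x; exists c.
Qed.

Lemma dist_code_eq0 C x : (dist_code x C == 0%N) = (x \in C).
Proof.
rewrite -leqn0; apply/dist_code_leP/idP => [[c cC]|xC].
  by rewrite leqn0 hdistE wt_eq0 addr_eq0_F2 => /eqP ->.
by exists x; rewrite // hdistE addrr_F2 wt0.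
Qed.

Lemma dist_code_lipschitz C x k : (dist_code x C <= (dist_code (x + 'e_k) C).+1)%N.
Proof.
have [c cC ->] := dist_code_attained C (x + 'e_k).
apply/dist_code_leP; exists c => //.
by rewrite !hdistE addrAC wtD_unit; case: ifP => _; rewrite ?leqSpred // ltnW.
Qed.

Lemma dist_code_descent C x : (0 < dist_code x C)%N ->
  exists k, dist_code x C = (dist_code (x + 'e_k) C).+1.
Proof.
have [c cC dxc] := dist_code_attained C x; rewrite dxc hdistE => wxc_gt0.
have /card_gt0P[k] := wxc_gt0; rewrite inE => xck; exists k; apply/eqP.
rewrite eqn_leq -{1}hdistE -dxc dist_code_lipschitz -(prednK wxc_gt0) ltnS.
by apply/dist_code_leP; exists c; rewrite // hdistE addrAC wtD_unit (negPf xck).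
Qed.

Lemma lipschitz_le_descending (d d' : 'rV['F_2]_N -> nat) :
    (forall x, d' x = 0%N -> d x = 0%N) ->
    (forall x k, (d x <= (d (x + 'e_k)%R).+1)%N) ->
    (forall x, (0 < d' x)%N -> exists k, d' x = (d' (x + 'e_k)).+1) ->
  forall x, (d x <= d' x)%N.
Proof.
move=> d0 d_lip d'_desc x; have [l] := ubnP (d' x); elim: l x => // l IHl x.
rewrite ltnS => d'l; have [d'0|d'_gt0] := posnP (d' x); first by rewrite d0.
have [k d'k] := d'_desc x d'_gt0; apply: leq_trans (d_lip x k) _.
by rewrite d'k ltnS IHl // -d'k.
Qed.

Lemma dist_code_coset C x c : c \in C -> dist_code (x + c) C = dist_code x C.
Proof.
have dist_coset_le d y : d \in C -> (dist_code (y + d) C <= dist_code y C)%N.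
  move=> dC; have [e eC ->] := dist_code_attained C y.
  apply/dist_code_leP; exists (e + d); first exact: memvD.
  by rewrite !hdistE addrACA addrr_F2 addr0.
move=> cC; apply/eqP; rewrite eqn_leq dist_coset_le //=.
by rewrite -{1}[x](addrK_F2 c) dist_coset_le.
Qed.

Lemma dist_code_onto C l :
  (l <= covering_radius C)%N -> exists x, dist_code x C = l.
Proof.
have [|xmax _ radE] := @eq_bigmax_cond _ predT (fun x => dist_code x C).
  by apply/card_gt0P; exists 0.
move=> le_l; have: exists x, dist_code x C = covering_radius C by exists xmax.
rewrite -(subnK le_l); elim: (_ - _)%N => // j IHj [y dy]; apply: IHj.
have [|k] := @dist_code_descent C y; first by rewrite dy.
by rewrite dy addSn => -[dk]; exists (y + 'e_k).
Qed.

Lemma covering_radius_regular C b c rho :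
    completely_regular_with C b c ->
    (forall l, (l < rho)%N -> (0 < b l)%N) -> b rho = 0%N ->
  covering_radius C = rho.
Proof.
move=> reg b_gt0 b_rho; apply/eqP; rewrite eqn_leq; apply/andP; split.
  rewrite leqNgt; apply/negP => /dist_code_onto[x dx].
  have [|k] := @dist_code_descent C x; first by rewrite dx.
  rewrite dx => -[dk]; have [/eqP] := reg (x + 'e_k).
  rewrite -dk b_rho cards_eq0 => /eqP/setP/(_ x); rewrite !inE dx -dk eqxx andbT.
  by move=> /hdist_eq1P[]; exists k; rewrite addrK_F2.
suff [x <-] : exists x, dist_code x C = rho by apply: leq_bigmax_cond.
elim: {-2}rho (leqnn rho) => [|l IHl] l_rho.
  by exists 0; apply/eqP; rewrite dist_code_eq0 mem0v.
have [x dx] := IHl (ltnW l_rho); have [upE _] := reg x.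
have /card_gt0P[y] : (0 < #|upper_nbrs C x|)%N by rewrite upE dx b_gt0.
by rewrite inE dx => /andP[_ /eqP]; exists y.
Qed.

Lemma intersection_array_regular C (bs cs : seq nat) :
    completely_regular_with C (nth 0%N bs) (nth 0%N (0%N :: cs)) ->
    size cs = size bs -> all (leq 1) bs ->
  covering_radius C = size bs /\ is_intersection_array C bs cs.
Proof.
move=> reg size_cs bs_gt0; have rho : covering_radius C = size bs.
  apply: covering_radius_regular reg _ _; last exact: nth_default.
  by move=> l l_lt; apply: (allP bs_gt0); apply: mem_nth.
split=> //; exists (nth 0%N bs), (nth 0%N (0%N :: cs)); rewrite rho; split=> //.
  by rewrite -[LHS](mkseq_nth 0%N).
by rewrite (iotaDl 1 0) -map_comp -size_cs -[LHS](mkseq_nth 0%N).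
Qed.

Lemma wt_perm_word x (s : 'S_N) : wt (perm_word x s) = wt x.
Proof.
rewrite /wt -[RHS](card_imset _ (@perm_inj _ s)); apply: eq_card => i.
rewrite inE mxE; apply/idP/imsetP => [xi|[j]].
  by exists (s^-1%g i); rewrite ?inE ?permKV.
by rewrite inE => xj ->; rewrite permK.
Qed.

Lemma perm_wordD x y (s : 'S_N) : perm_word (x + y) s = perm_word x s + perm_word y s.
Proof. exact: linearD. Qed.

Lemma code_autP C (s : 'S_N) :
  reflect (forall x, x \in C -> perm_word x s \in C) (s \in code_aut C).
Proof.
by rewrite !inE; apply: (iffP subsetP) => sC x; have := sC x; rewrite !inE.
Qed.

Lemma mem_perm_word C x (s : 'S_N) : s \in code_aut C -> (perm_word x s \in C) = (x \in C).
Proof. by move=> /(astabs_act x); rewrite !inE. Qed.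

Lemma dist_code_perm C x (s : 'S_N) :
  s \in code_aut C -> dist_code (perm_word x s) C = dist_code x C.
Proof.
have dist_perm_le t y : t \in code_aut C -> (dist_code (perm_word y t) C <= dist_code y C)%N.
  move=> tC; have [c cC ->] := dist_code_attained C y.
  apply/dist_code_leP; exists (perm_word c t); first by rewrite mem_perm_word.
  by rewrite !hdistE -perm_wordD wt_perm_word.
move=> sC; apply/eqP; rewrite eqn_leq dist_perm_le //=.
by rewrite -{1}[x](actK (perm_word_action N) s) dist_perm_le ?groupV.
Qed.

Lemma mem_code_coset C x y : (y \in code_coset C x) = (x + y \in C).
Proof.
apply/imsetP/idP => [[c cC ->]|xyC]; first by rewrite addKr_F2.
by exists (x + y) => //; rewrite addKr_F2.
Qed.

Lemma eq_code_coset C x y : x + y \in C -> code_coset C x = code_coset C y.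
Proof.
move=> xyC; apply/setP=> z; rewrite !mem_code_coset.
by rewrite -[y](addKr_F2 x) addrAC [RHS]rpredDr.
Qed.

Lemma code_coset_perm C x (s : 'S_N) : s \in code_aut C ->
  ((perm_word_action N)^*)%act (code_coset C x) s = code_coset C (perm_word x s).
Proof.
move=> sC; apply/setP=> y; rewrite -[y](actKV (perm_word_action N) s).
rewrite (mem_imset _ _ (act_inj (perm_word_action N) s)) !mem_code_coset.
by rewrite -perm_wordD mem_perm_word.
Qed.

Definition coset_orbit C x :=
  orbit ((perm_word_action N)^*)%act (code_aut C) (code_coset C x).

Lemma coset_orbit_perm C x (s : 'S_N) :
  s \in code_aut C -> coset_orbit C (perm_word x s) = coset_orbit C x.
Proof. by move=> sC; rewrite /coset_orbit -code_coset_perm ?orbit_act. Qed.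

Lemma dist_code_coset_orbit C x y :
  coset_orbit C x = coset_orbit C y -> dist_code x C = dist_code y C.
Proof.
move=> orb_xy; have /orbitP[s sC cosetE] : code_coset C x \in coset_orbit C y.
  by rewrite -orb_xy orbit_refl.
have : perm_word y s \in code_coset C x.
  by rewrite -cosetE code_coset_perm // mem_code_coset addrr_F2 mem0v.
by rewrite mem_code_coset => /(dist_code_coset x) <-; rewrite addKr_F2 dist_code_perm.
Qed.

Lemma completely_transitive_dist C :
    (forall x y, dist_code x C = dist_code y C -> coset_orbit C x = coset_orbit C y) ->
  completely_transitive C.
Proof.
move=> orb_dist; pose rho := covering_radius C.
have rep_ex (l : 'I_rho.+1) : exists x, dist_code x C == l.
  by have [x <-] := @dist_code_onto C l (ltn_ord l); exists x.
pose rep l := xchoose (rep_ex l).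
have dist_rep l : dist_code (rep l) C = l by apply/eqP/(xchooseP (rep_ex l)).
have orb_inj : injective (fun l => coset_orbit C (rep l)).
  by move=> i j /dist_code_coset_orbit; rewrite !dist_rep => /val_inj.
rewrite /completely_transitive -/rho -[rho.+1]card_ord -[RHS](card_imset _ orb_inj).
apply: eq_card => A; apply/imsetP/imsetP => -[x _ ->]; last by exists (rep x).
have x_rho : (dist_code x C < rho.+1)%N by rewrite ltnS; apply: leq_bigmax_cond.
by exists (Ordinal x_rho) => //; apply: orb_dist; rewrite dist_rep.
Qed.

End HammingDistance.

(** * Syndromes *)

Section Syndrome.
Variables (N : nat) (W : lmodType 'F_2).
Implicit Types (c : 'I_N -> W) (x y : 'rV['F_2]_N) (C : {vspace 'rV['F_2]_N}).

Definition syndrome c x : W := \sum_i x 0 i *: c i.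

Fact syndrome_is_linear c : linear (syndrome c).
Proof.
move=> a x y; rewrite /syndrome scaler_sumr -big_split.
by apply: eq_bigr => i _; rewrite !mxE scalerDl scalerA.
Qed.

HB.instance Definition _ c :=
  GRing.isLinear.Build 'F_2 'rV['F_2]_N W *:%R (syndrome c) (syndrome_is_linear c).

Lemma syndrome_unit c k : syndrome c 'e_k = c k.
Proof.
rewrite /syndrome (bigD1 k) //= mxE !eqxx scale1r big1 ?addr0 // => i /negPf ik.
by rewrite mxE ik andbF scale0r.
Qed.

Lemma syndromeD_unit c x k : syndrome c (x + 'e_k) = syndrome c x + c k.
Proof. by rewrite linearD /= syndrome_unit. Qed.

Lemma syndrome_perm_word c x (s : 'S_N) : syndrome c (perm_word x s) = syndrome (c \o s) x.
Proof.
rewrite /syndrome (reindex_inj (@perm_inj _ s)).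
by apply: eq_bigr => i _; rewrite mxE permK.
Qed.

(* The [c k] are the columns of a parity check matrix of [C], read in a basis of [W]. *)
Definition check_columns C c := forall x, (x \in C) = (syndrome c x == 0).

End Syndrome.

Lemma syndrome_morph (N : nat) (W W' : lmodType 'F_2) (T : W -> W')
    (c : 'I_N -> W) (c' : 'I_N -> W') (x : 'rV['F_2]_N) :
    {morph T : s t / s + t} -> (forall k, T (c k) = c' k) ->
  T (syndrome c x) = syndrome c' x.
Proof.
move=> TD Tc; rewrite /syndrome (big_morph T TD (morphD0 TD)).
by apply: eq_bigr => k _; rewrite morphDZ_F2 ?Tc.
Qed.

Lemma check_columns_inj (N : nat) (W W' : lmodType 'F_2) (T : W -> W')
    (C : {vspace 'rV['F_2]_N}) (c : 'I_N -> W) (c' : 'I_N -> W') :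
    {morph T : s t / s + t} -> injective T -> (forall k, T (c k) = c' k) ->
  check_columns C c -> check_columns C c'.
Proof.
move=> TD T_inj Tc memC x; rewrite memC -(syndrome_morph x TD Tc) -(inj_eq T_inj).
by rewrite morphD0.
Qed.

Lemma leq_dim_code (N : nat) (W : vectType 'F_2) (C : {vspace 'rV['F_2]_N})
    (c : 'I_N -> W) :
  (forall x, syndrome c x = 0 -> x \in C) -> (N <= \dim C + dim W)%N.
Proof.
move=> kerC; pose S := linfun (syndrome c).
have := limg_ker_dim S fullv; rewrite capfv dimvf dim_matrix mul1r => dimN.
rewrite -[leqLHS]dimN leq_add // -?dimvf ?dimvS ?subvf //.
by apply/subvP=> x; rewrite memv_ker lfunE => /eqP /kerC.
Qed.

Section CheckColumns.
Variables (N : nat) (W : lmodType 'F_2) (c : 'I_N -> W) (C : {vspace 'rV['F_2]_N}).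
Hypothesis memC : check_columns C c.
Implicit Types (x y : 'rV['F_2]_N) (s : W).
Local Notation S := (syndrome c).

Lemma dist_code_eq1 x :
  (dist_code x C == 1%N) = (S x != 0) && [exists k, S x == c k].
Proof.
apply/eqP/andP => [dx|[Sx_neq0 /existsP[k /eqP Sx]]].
  split; first by rewrite -memC -dist_code_eq0 dx.
  have [|k] := @dist_code_descent _ C x; first by rewrite dx.
  rewrite dx => -[/esym/eqP]; rewrite dist_code_eq0 memC syndromeD_unit addr_eq0_F2 => Sx.
  by apply/existsP; exists k.
apply/eqP; rewrite eqn_leq lt0n dist_code_eq0 memC Sx_neq0 andbT.
apply: leq_trans (dist_code_lipschitz C x k) _.
by rewrite ltnS leqn0 dist_code_eq0 memC syndromeD_unit Sx addrr_F2.
Qed.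

Section EquitableDistance.
Variables (d : W -> nat) (p : nat -> nat -> nat).
Hypothesis d_eq0 : forall s, (d s == 0%N) = (s == 0).
Hypothesis d_equitable : forall s l, #|[set k | d (s + c k) == l]| = p (d s) l.
Hypothesis p_banded : forall i j, (j.+1 < i)%N -> p i j = 0%N.
Hypothesis p_descends : forall s, (0 < d s)%N -> (0 < p (d s) (d s).-1)%N.

(* [dist_code^~ C] and [d] at the syndrome have the same zeros, change by at most one along an
   edge of the Hamming graph, and decrease along some edge wherever they are positive. *)
Lemma dist_code_equitable x : dist_code x C = d (S x).
Proof.
have zeroE y : (dist_code y C == 0%N) = (d (S y) == 0%N).
  by rewrite dist_code_eq0 memC d_eq0.
apply/eqP; rewrite eqn_leq; apply/andP; split.
  apply: (@lipschitz_le_descending _ (fun y => dist_code y C) (fun y => d (S y))) => {}x.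
  - by move=> /eqP; rewrite -zeroE => /eqP.
  - exact: dist_code_lipschitz.
  - move=> dx_gt0; have := p_descends dx_gt0; rewrite -d_equitable => /card_gt0P[k].
    by rewrite inE => /eqP dk; exists k; rewrite syndromeD_unit dk prednK.
apply: (@lipschitz_le_descending _ (fun y => d (S y)) (fun y => dist_code y C)) => {}x.
- by move=> /eqP; rewrite zeroE => /eqP.
- move=> k; rewrite syndromeD_unit leqNgt; apply/negP => /p_banded.
  by rewrite -d_equitable => /eqP; rewrite cards_eq0 => /eqP/setP/(_ k); rewrite !inE eqxx.
- exact: dist_code_descent.
Qed.

Lemma completely_regular_equitable :
  completely_regular_with C (fun i => p i i.+1) (fun i => if i is j.+1 then p i j else 0%N).
Proof.
have nbrE x l : #|[set y | (hdist x y == 1%N) && (dist_code y C == l)]| = p (dist_code x C) l.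
  rewrite (card_neighbors x (fun y => dist_code y C == l)) dist_code_equitable -d_equitable.
  by apply: eq_card => k; rewrite !inE dist_code_equitable syndromeD_unit.
move=> x; split; first exact: nbrE.
rewrite /lower_nbrs; case: (dist_code x C) (nbrE x) => [|l] {}nbrE; last exact: nbrE.
by apply: eq_card0 => y; rewrite inE andbF.
Qed.

End EquitableDistance.

Definition column_symmetry (T : W -> W) :=
  {morph T : s t / s + t} /\ exists p : 'S_N, forall k, T (c k) = c (p k).

Lemma column_symmetry_comp T U :
  column_symmetry T -> column_symmetry U -> column_symmetry (T \o U).
Proof.
move=> [TD [p Tp]] [UD [q Uq]]; split=> [s t|]; first by rewrite /= UD TD.
by exists (q * p)%g => k; rewrite /= Uq Tp permM.
Qed.

Lemma coset_orbit_symmetry T x y :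
  column_symmetry T -> S y = T (S x) -> coset_orbit C y = coset_orbit C x.
Proof.
move=> [TD [p Tp]] Sy.
have Sp z : S (perm_word z p) = T (S z).
  by rewrite syndrome_perm_word (syndrome_morph z TD Tp).
have pC : p \in code_aut C.
  by apply/code_autP => z; rewrite !memC Sp => /eqP ->; apply/eqP/morphD0.
rewrite -(coset_orbit_perm x pC) /coset_orbit (@eq_code_coset _ C y (perm_word x p)) //.
by rewrite memC linearD /= Sp Sy addrr_F2.
Qed.

Lemma completely_transitive_symmetry :
    (forall x y, dist_code x C = dist_code y C ->
       exists2 T, column_symmetry T & T (S x) = S y) ->
  completely_transitive C.
Proof.
move=> symC; apply: completely_transitive_dist => x y /symC[T symT Txy].
by rewrite (coset_orbit_symmetry symT (esym Txy)).
Qed.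

End CheckColumns.

(** * Codes of quadratic graphs *)

Section QuadraticForms.
Variables (V : lmodType 'F_2) (f : V -> 'F_2).
Implicit Types (u v w : V) (a : 'F_2).

Definition polar u v : 'F_2 := f (u + v) + f u + f v.

Definition quadratic := forall w, {morph polar^~ w : u v / u + v}.

Definition nondegenerate_polar := forall u, u != 0 -> exists v, polar u v = 1.

Lemma polarC u v : polar u v = polar v u.
Proof. by rewrite /polar addrAC [u + v]addrC. Qed.

Lemma formD_polar u v : f (u + v) = f u + f v + polar u v.
Proof.
rewrite /polar -addrA addrC; case: (F2P (f (u + v))); case: (F2P (f u));
by case: (F2P (f v)); apply/eqP.
Qed.

Hypothesis f_quad : quadratic.

Lemma polar0l v : polar 0 v = 0.
Proof. exact: (morphD0 (f_quad v)). Qed.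

Lemma polarDr u v w : polar u (v + w) = polar u v + polar u w.
Proof. by rewrite ![polar u _]polarC f_quad. Qed.

Lemma polarZl a u v : polar (a *: u) v = a * polar u v.
Proof. exact: (morphDZ_F2 (V := ('F_2)^o) a u (f_quad v)). Qed.

Lemma polarZr a u v : polar u (a *: v) = a * polar u v.
Proof. by rewrite polarC polarZl polarC. Qed.

Lemma quadratic0 : f 0 = 0.
Proof. by have := polar0l 0; rewrite /polar addr0; case: (F2P (f 0)). Qed.

Lemma polarvv u : polar u u = 0.
Proof. by rewrite /polar addrr_F2 quadratic0; case: (F2P (f u)); apply/eqP. Qed.

Lemma quadraticZ a u : f (a *: u) = a * f u.
Proof. by case: (F2P a); rewrite ?scale0r ?scale1r ?mul0r ?mul1r ?quadratic0. Qed.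

Lemma polar_common_eq1 s s' : nondegenerate_polar -> s != 0 -> s' != 0 ->
  exists w, polar s w = 1 /\ polar w s' = 1.
Proof.
move=> nondeg /nondeg[v sv] /nondeg[v' s'v'].
case s'v: _ / (F2P (polar s' v)); last by exists v; rewrite [polar v _]polarC.
case sv': _ / (F2P (polar s v')); last by exists v'; rewrite [polar v' _]polarC.
by exists (v + v'); rewrite [polar _ s']polarC !polarDr sv sv' s'v s'v' addr0 add0r.
Qed.

End QuadraticForms.

Lemma card_polar_eq (V : finLmodType 'F_2) (f : V -> 'F_2) u w t :
  quadratic f -> polar f u w = 1 -> #|[set v | polar f u v == t]| = #|V|./2.
Proof.
move=> f_quad uw; pose A := [set v | polar f u v == t].
suff cardAC : #|~: A| = #|A| by rewrite -(cardsC A) cardAC addnn doubleK.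
rewrite -[RHS](card_imset _ (@addrI _ w)); apply: eq_card => v.
rewrite -[v in RHS](addKr_F2 w) (mem_imset _ _ (@addrI _ w)) !inE polarDr // uw.
by case: (F2P t); case: (F2P (polar f u v)).
Qed.

Local Notation synd V := (('F_2)^o * V * ('F_2)^o)%type.

Section GraphColumns.
Variables (V : finLmodType 'F_2) (f : V -> 'F_2) (N : nat) (h : 'I_N -> V).
Hypothesis h_bij : bijective h.
Implicit Types (b u v : V).
Implicit Types sg : synd V.

Definition graph_point v : synd V := (1, v, f v).

Lemma column_symmetry_graph (T : synd V -> synd V) (g : V -> V) :
    {morph T : sg sg' / sg + sg'} -> injective g ->
    (forall v, T (graph_point v) = graph_point (g v)) ->
  column_symmetry (graph_point \o h) T.
Proof.
move=> TD g_inj Tg; split=> //; have [h' hK h'K] := h_bij.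
have p_inj : injective (h' \o g \o h).
  by apply: inj_comp (can_inj hK); apply: inj_comp g_inj; apply: can_inj h'K.
by exists (perm p_inj) => k; rewrite permE /= h'K.
Qed.

(* The linear maps sending the column of [v] to that of [v + b], resp.
   [v + polar f v u *: u]. *)
Definition translate b sg : synd V :=
  let: (a, s, t) := sg in (a, s + (a : 'F_2) *: b, t + a * f b + polar f s b).

Definition transvect u sg : synd V :=
  let: (a, s, t) := sg in (a, s + polar f s u *: u, t + polar f s u * (f u + 1)).

Hypothesis f_quad : quadratic f.

Lemma translate_symmetry b : column_symmetry (graph_point \o h) (translate b).
Proof.
apply: (column_symmetry_graph (g := +%R^~ b)).
- move=> [[a s] t] [[a' s'] t']; congr (_, _, _) => /=.
    by rewrite scalerDl addrACA.
  by rewrite mulrDl f_quad (addrACA t t') [LHS]addrACA.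
- exact: addIr.
- by move=> v; rewrite /graph_point formD_polar /= scale1r mul1r.
Qed.

Lemma transvect_symmetry u : column_symmetry (graph_point \o h) (transvect u).
Proof.
pose g v := v + polar f v u *: u.
have g_invol : involutive g.
  by move=> v; rewrite /g f_quad polarZl // polarvv // mulr0 addr0 addrK_F2.
apply: (column_symmetry_graph (g := g)).
- move=> [[a s] t] [[a' s'] t']; rewrite /= f_quad; congr (_, _, _) => /=.
    by rewrite scalerDl addrACA.
  by rewrite mulrDl addrACA.
- exact: can_inj g_invol.
- move=> v; rewrite /graph_point /g /= formD_polar (quadraticZ f_quad) (polarZr f_quad) -addrA.
  by congr (_, _, f v + _); case: (F2P (polar f v u)); rewrite ?mul0r ?mul1r ?addr0.
Qed.

End GraphColumns.

Section BentCodes.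
Variables (V : finLmodType 'F_2) (f : V -> 'F_2) (N : nat) (h : 'I_N -> V).
Variable C : {vspace 'rV['F_2]_N}.
Hypothesis V_gt1 : (1 < #|V|)%N.
Hypothesis f_quad : quadratic f.
Hypothesis f_nondeg : nondegenerate_polar f.
Hypothesis h_bij : bijective h.
Hypothesis memC : check_columns C (graph_point f \o h).
Implicit Types (s v : V) (t : 'F_2).
Implicit Types sg : synd V.
Local Notation point := (graph_point f).

Definition bent_dist sg : nat :=
  let: (a, s, t) := sg in
  (if a == 0%R then if s != 0%R then 2 else if t == 0%R then 0 else 4
   else if t == f s then 1 else 3)%N.

Lemma synd_ind (P : synd V -> Prop) :
    (forall t, P (0, 0, t)) -> (forall s t, s != 0 -> P (0, s, t)) ->
    (forall s t, P (1, s, t)) ->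
  forall sg, P sg.
Proof.
move=> P_center P_even P_odd [[a s] t]; case: (F2P a) => //.
by have [->|] := eqVneq s 0; [apply: P_center | apply: P_even].
Qed.

Lemma bent_dist_eq0 sg : (bent_dist sg == 0%N) = (sg == 0).
Proof.
elim/synd_ind: sg => [t|s t s_neq0|s t] /=; rewrite !xpair_eqE /= ?eqxx.
- by case: ifP.
- by rewrite s_neq0 (negPf s_neq0).
- by case: ifP.
Qed.

Lemma bent_dist_center_point t v :
  bent_dist ((0, 0, t) + point v) = if t == 0 then 1%N else 3%N.
Proof. by rewrite /= !add0r -subr_eq0 addrK. Qed.

Lemma bent_dist_even_point s t v :
  bent_dist ((0, s, t) + point v) = if polar f s v == t + f s then 1%N else 3%N.
Proof.
rewrite /= formD_polar; case: (F2P t); case: (F2P (f s)); case: (F2P (f v));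
by case: (F2P (polar f s v)).
Qed.

Lemma bent_dist_odd_point s t v :
  bent_dist ((1, s, t) + point v) =
    if v == s then if t == f s then 0%N else 4%N else 2%N.
Proof.
rewrite /= addr_eq0_F2 [s == v]eq_sym /=; case: eqVneq => //= ->.
by rewrite (addr_eq0_F2 (V := ('F_2)^o)).
Qed.

Definition bent_intersection_numbers : seq (seq nat) :=
  let q := #|V| in
  [:: [:: 0; q;    0;    0;    0];
      [:: 1; 0;    q.-1; 0;    0];
      [:: 0; q./2; 0;    q./2; 0];
      [:: 0; 0;    q.-1; 0;    1];
      [:: 0; 0;    0;    q;    0]]%N.

Local Notation inter i j := (nth 0%N (nth [::] bent_intersection_numbers i) j).

Lemma card_bent_dist_step sg l :
  #|[set v | bent_dist (sg + point v) == l]| = inter (bent_dist sg) l.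
Proof.
elim/synd_ind: sg => [t|s t s_neq0|s t].
- under eq_finset => v do rewrite bent_dist_center_point.
  have card_const (b : bool) : #|[set v : V | b]| = (b * #|V|)%N.
    by case: b; rewrite ?mul1n; [apply: cardsT | apply: cards0].
  rewrite card_set_if !card_const /= eqxx.
  case: (F2P t); case: l => [|[|[|[|[|l]]]]];
  by rewrite /= ?nth_nil !(mul0n, mul1n, add0n, addn0).
- have [w sw] := f_nondeg s_neq0; under eq_finset => v do rewrite bent_dist_even_point.
  rewrite card_set_if.
  under [X in (_ + _ * #|pred_of_set X|)%N]eq_finset => v do rewrite neq_F2.
  rewrite !(card_polar_eq _ f_quad sw) /= s_neq0.
  by case: l => [|[|[|[|[|l]]]]]; rewrite /= ?nth_nil !(mul0n, mul1n, add0n, addn0).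
- under eq_finset => v do rewrite bent_dist_odd_point.
  rewrite card_set_if !cardsE card1 cardC1 /=.
  case: (t == f s); case: l => [|[|[|[|[|l]]]]];
  by rewrite /= ?nth_nil !(mul0n, mul1n, add0n, addn0).
Qed.

Lemma bent_intersection_banded i j : (j.+1 < i)%N -> inter i j = 0%N.
Proof.
by case: i => [|[|[|[|[|i]]]]]; case: j => [|[|[|j]]]; rewrite //= ?nth_nil.
Qed.

Lemma bent_intersection_descends sg : (0 < bent_dist sg)%N ->
  (0 < inter (bent_dist sg) (bent_dist sg).-1)%N.
Proof.
have halfV_gt0 : (0 < #|V|./2)%N by rewrite half_gt0.
elim/synd_ind: sg => [t|s t s_neq0|s t] /=.
- by rewrite eqxx; case: ifP => //= _ _; apply: ltnW.
- by rewrite s_neq0.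
- by case: ifP => //= _ _; rewrite -subn1 subn_gt0.
Qed.

Lemma card_bent_dist_column sg l :
  #|[set k | bent_dist (sg + (point \o h) k) == l]| = inter (bent_dist sg) l.
Proof.
rewrite -card_bent_dist_step.
exact: (card_preim_bij (fun v => bent_dist (sg + point v) == l) h_bij).
Qed.

Lemma dist_code_bent x : dist_code x C = bent_dist (syndrome (point \o h) x).
Proof.
exact: (dist_code_equitable memC bent_dist_eq0 card_bent_dist_column
  bent_intersection_banded bent_intersection_descends).
Qed.

Lemma intersection_array_bent :
  covering_radius C = 4%N /\
  is_intersection_array C [:: #|V|; #|V|.-1; #|V|./2; 1%N] [:: 1%N; #|V|./2; #|V|.-1; #|V|].
Proof.
rewrite -[4%N]/(size [:: #|V|; #|V|.-1; #|V|./2; 1%N]).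
apply: intersection_array_regular => //; last first.
  by rewrite /= half_gt0 V_gt1 andbT -subn1 subn_gt0 V_gt1 ltnW.
move=> x; have [-> ->] := completely_regular_equitable memC bent_dist_eq0
  card_bent_dist_column bent_intersection_banded bent_intersection_descends x.
by case: (dist_code x C) => [|[|[|[|[|i]]]]]; rewrite /= ?nth_nil.
Qed.

Lemma symmetry_transitive_odd s t s' t' : t + f s = t' + f s' ->
  exists2 T, column_symmetry (point \o h) T & T (1, s, t) = (1, s', t').
Proof.
move=> ts; have -> : t = t' + f s' + f s by rewrite -ts (addrK_F2 (V := ('F_2)^o)).
exists (translate f (s + s')); first exact: translate_symmetry.
rewrite /translate scale1r mul1r addKr_F2 (polarDr f_quad) (polarvv f_quad) add0r.
rewrite (formD_polar f s s'); congr (_, _, _).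
case: (F2P t'); case: (F2P (f s)); case: (F2P (f s')); case: (F2P (polar f s s'));
by apply/eqP.
Qed.

(* The transvection along [s + s'] maps [s] to [s'] when [polar f s s' = 1]. *)
Lemma symmetry_transitive_even s t s' t' : s != 0 -> s' != 0 ->
  exists2 T, column_symmetry (point \o h) T & T (0, s, t) = (0, s', t').
Proof.
have move_even u v r : polar f u v = 1 ->
    exists r', transvect f (u + v) (0, u, r) = (0, v, r').
  move=> uv; eexists; rewrite /transvect (polarDr f_quad) (polarvv f_quad) uv add0r.
  by rewrite scale1r addKr_F2.
move=> s_neq0 s'_neq0; have [w [sw ws']] := polar_common_eq1 f_quad f_nondeg s_neq0 s'_neq0.
have [v s'v] := f_nondeg s'_neq0.
have [r1 T1] := move_even s w t sw; have [r2 T2] := move_even w s' r1 ws'.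
exists (translate f ((r2 + t') *: v) \o (transvect f (w + s') \o transvect f (s + w))).
  apply: column_symmetry_comp; first exact: translate_symmetry.
  by apply: column_symmetry_comp; apply: transvect_symmetry.
rewrite /comp T1 T2 /translate scale0r mul0r !addr0 (polarZr f_quad) s'v mulr1.
by rewrite (addKr_F2 (V := ('F_2)^o)).
Qed.

Lemma symmetry_transitive_bent sg sg' : bent_dist sg = bent_dist sg' ->
  exists2 T, column_symmetry (point \o h) T & T sg = sg'.
Proof.
have center_even s t t' : s != 0 -> bent_dist (0, 0, t) != bent_dist (0, s, t').
  by move=> /= ->; rewrite eqxx; case: ifP.
elim/synd_ind: sg => [t|s t s_neq0|s t]; elim/synd_ind: sg' => [t'|s' t' s'_neq0|s' t'] dist_eq.
- exists (translate f 0); first exact: translate_symmetry.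
  rewrite /translate scaler0 mul0r polar0l // !addr0; congr (_, _, _).
  by move: dist_eq; rewrite /= eqxx; case: (F2P t); case: (F2P t').
- by case/eqP: (center_even s' t t' s'_neq0).
- by move: dist_eq; rewrite /= eqxx; do 2!case: ifP.
- by case/eqP: (center_even s t' t s_neq0).
- exact: symmetry_transitive_even.
- by move: dist_eq; rewrite /= s_neq0; case: ifP.
- by move: dist_eq; rewrite /= eqxx; do 2!case: ifP.
- by move: dist_eq; rewrite /= s'_neq0; case: ifP.
- apply: symmetry_transitive_odd; move: dist_eq => /=.
  by case: (F2P t); case: (F2P (f s)); case: (F2P t'); case: (F2P (f s')) => // _; apply/eqP.
Qed.

Lemma completely_transitive_bent : completely_transitive C.
Proof.
apply: (completely_transitive_symmetry memC) => x y.
by rewrite !dist_code_bent => /symmetry_transitive_bent.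
Qed.

End BentCodes.

Section GraphPairs.
Variables (V : finLmodType 'F_2) (f : V -> 'F_2) (N : nat) (h : 'I_N -> V).
Variable C : {vspace 'rV['F_2]_N}.
Hypothesis h_bij : bijective h.
Hypothesis memC : check_columns C (graph_point f \o h).
Variables (k l : 'I_N).
Hypothesis neq_kl : k != l.
Local Notation pair_word := ('e_k + 'e_l).

Lemma dist_code_pair : dist_code pair_word C = 2%N.
Proof.
have Sx : syndrome (graph_point f \o h) pair_word = graph_point f (h k) + graph_point f (h l).
  by rewrite syndromeD_unit syndrome_unit.
apply/eqP; rewrite eqn_leq; apply/andP; split.
  apply/dist_code_leP; exists 0; first exact: mem0v.
  by rewrite hdistE addr0 wtD_unit wt_unit; case: ifP.
rewrite ltnNge leq_eqVlt ltnS leqn0 dist_code_eq0 memC (dist_code_eq1 memC) Sx negb_or negb_and.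
apply/andP; split.
  by apply/orP; right; apply/existsPn => j; apply: contraNneq neq_kl => -[].
by rewrite addr_eq0_F2; apply: contraNneq neq_kl => -[/(bij_inj h_bij) ->].
Qed.

Lemma card_lower_nbrs_pair :
  #|lower_nbrs C pair_word| =
    #|[set w | f (h k + h l + w) == f (h k) + f (h l) + f w]|.
Proof.
rewrite (card_neighbors _ (fun y => (dist_code y C).+1 == dist_code pair_word C)).
rewrite dist_code_pair -(card_preim_bij _ h_bij); apply: eq_card => j; rewrite !inE eqSS.
have Sy : syndrome (graph_point f \o h) (pair_word + 'e_j) =
    (1, h k + h l + h j, f (h k) + f (h l) + f (h j)).
  by rewrite !syndromeD_unit syndrome_unit; congr (_, _, _); apply/eqP.
rewrite (dist_code_eq1 memC) Sy.
have [h' _ h'K] := h_bij; apply/andP/eqP => [[_ /existsP[i /eqP[-> ->]]] // | fD].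
split=> //; apply/existsP; exists (h' (h k + h l + h j)).
by rewrite /= h'K /graph_point fD.
Qed.

End GraphPairs.

Lemma card_lower_nbrs_punctured (V : finLmodType 'F_2) (f q : V -> 'F_2) (N : nat)
    (h : 'I_N -> V) (C : {vspace 'rV['F_2]_N}) :
    (5 < #|V|)%N -> quadratic q -> (forall v, f v = q v + (v != 0)%:R) ->
    bijective h -> check_columns C (graph_point f \o h) ->
  exists2 x, dist_code x C = 2%N & #|lower_nbrs C x| != #|V|./2.
Proof.
move=> V_gt5 q_quad fE h_bij memC; have [h' hK h'K] := h_bij.
have [s s_neq0] : exists s : V, s != 0.
  have: (0 < #|[set~ 0%R : V]|)%N by rewrite cardsC1; case: #|_| V_gt5 => [|[]].
  by case/card_gt0P=> s; rewrite !inE; exists s.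
have neq_0s : h' 0 != h' s by rewrite (can_eq h'K) eq_sym.
exists ('e_(h' 0) + 'e_(h' s)); first exact: (dist_code_pair h_bij memC).
rewrite (card_lower_nbrs_pair h_bij memC) // !h'K add0r.
have -> : [set w | f (s + w) == f 0 + f s + f w]
    = [set w | polar q s w == 1] :|: [set 0; s].
  apply/setP=> w; rewrite !inE !fE eqxx (quadratic0 q_quad) s_neq0 addr_eq0_F2.
  have [->|w_neq0] := eqVneq w 0.
    by rewrite !addr0 s_neq0 orbT add0r !(quadratic0 q_quad) addr0 eqxx.
  have [->|w_neqs] := eqVneq w s.
    by rewrite !orbT addrr_F2 (quadratic0 q_quad); case: (F2P (q s)).
  rewrite orbF (formD_polar q).
  by case: (F2P (q s)); case: (F2P (q w)); case: (F2P (polar q s w)).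
have -> : #|[set w | polar q s w == 1] :|: [set 0; s]|
    = (#|[set w | polar q s w == 1%R]| + 2)%N.
  rewrite cardsU cards2 [0 == s]eq_sym s_neq0 (_ : _ :&: _ = set0) ?cards0 ?subn0 //.
  apply/setP=> w; rewrite !inE; apply/negP => /andP[sw /orP[] /eqP w0]; move: sw.
    by rewrite w0 polarC (polar0l q_quad).
  by rewrite w0 (polarvv q_quad).
have [->|[w]] := set_0Vmem [set w | polar q s w == 1].
  by rewrite cards0; case: #|V| V_gt5 => [|[|[|[|[|[|]]]]]].
by rewrite inE => /eqP /(card_polar_eq 1 q_quad) ->; rewrite -[X in _ != X]addn0 eqn_add2l.
Qed.

(** * Weights modulo 4 *)

Section WeightSum.
Variable m : nat.
Implicit Types (x y : 'rV['F_2]_m).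

Definition overlap x y : nat := #|[set i | (x 0 i != 0) && (y 0 i != 0)]|.

Lemma wtD x y : (wt (x + y)%R + (overlap x y).*2 = wt x + wt y)%N.
Proof.
pose X := [set i | x 0 i != 0]; pose Y := [set i | y 0 i != 0].
have -> : overlap x y = #|X :&: Y| by apply: eq_card => i; rewrite !inE.
have -> : wt (x + y) = #|(X :\: Y) :|: (Y :\: X)|.
  apply: eq_card => i; rewrite !inE mxE.
  by case: (F2P (x 0 i)); case: (F2P (y 0 i)).
have disj : (X :\: Y) :&: (Y :\: X) = set0.
  by apply/setP=> i; rewrite !inE; case: (x 0 i == 0); case: (y 0 i == 0).
have := cardsID Y X; have := cardsID X Y; rewrite [Y :&: X]setIC cardsU disj cards0.
by rewrite -/(wt x) -/(wt y) /wt -/X -/Y; lia.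
Qed.

Lemma odd_wtD x y : odd (wt (x + y)) = odd (wt x) (+) odd (wt y).
Proof. by rewrite -oddD -wtD oddD odd_double addbF. Qed.

Lemma odd_half_wtD x y :
  odd (wt (x + y))./2 =
    odd (wt x)./2 (+) odd (wt y)./2 (+) (odd (wt x) && odd (wt y)) (+) odd (overlap x y).
Proof.
have := congr1 (fun k => odd k./2) (wtD x y).
rewrite !halfD !oddD odd_double doubleK andbF !oddb /=.
by move=> /(canRL (addbK _)) ->; rewrite [_ && _ (+) _]addbC.
Qed.

Lemma sum_mul_overlap x y : \sum_i x 0 i * y 0 i = (odd (overlap x y))%:R.
Proof.
rewrite sum_odd_F2; congr (nat_of_bool (odd _))%:R.
by apply: eq_card => i; rewrite !inE mulf_eq0 negb_or.
Qed.

End WeightSum.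

Section WeightModFour.
Variables (m : nat) (i1 i2 : 'I_4).
Hypothesis neq_i12 : i1 != i2.
Implicit Types (x y : 'rV['F_2]_m).

Definition weight_class (w : nat) : bool := (w == i1 %[mod 4]) || (w == i2 %[mod 4]).

(* A two-element subset of Z/4 is an affine line in the two binary digits. *)
Lemma weight_class_bits w :
  weight_class w = weight_class 0 (+) (odd i1 (+) odd i2) && odd w./2
                   (+) (odd i1./2 (+) odd i2./2) && odd w.
Proof.
have odd4 : odd (w %% 4) = odd w by rewrite odd_mod.
have half4 : odd (w %% 4)./2 = odd w./2 by lia.
rewrite /weight_class -odd4 -half4 -(modn_mod w).
have := ltn_pmod w (isT : 0 < 4)%N; move: (w %% 4)%N => r.
case: i1 neq_i12 => [k1 lt1]; case: i2 => [k2 lt2]; rewrite -val_eqE /=.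
by case: k1 lt1 => [|[|[|[|]]]] // _; case: k2 lt2 => [|[|[|[|]]]] // _ _;
   case: r => [|[|[|[|]]]].
Qed.

Definition weight_form x : 'F_2 := (weight_class (wt x) (+) weight_class 0)%:R.

Lemma polar_weight_form x y :
  polar weight_form x y =
    (odd i1 (+) odd i2)%:R * ((\sum_i x 0 i) * (\sum_i y 0 i) + \sum_i x 0 i * y 0 i).
Proof.
rewrite sum_mul_overlap !sum_odd_F2 -!/(wt _) -!natrM !mulnb -natr_addb_F2 -natrM mulnb.
rewrite /polar /weight_form -!natr_addb_F2 !(weight_class_bits (wt _)) odd_half_wtD odd_wtD.
congr (nat_of_bool _)%:R.
case: (weight_class 0); case: (odd i1 (+) odd i2); case: (odd i1./2 (+) odd i2./2);
case: (odd (wt x)); case: (odd (wt y)); case: (odd (wt x)./2); case: (odd (wt y)./2);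
by case: (odd (overlap x y)).
Qed.

Lemma weight_form_quadratic : quadratic weight_form.
Proof.
move=> z x y; rewrite !polar_weight_form -mulrDr addrACA -mulrDl -!big_split /=.
by congr (_ * (_ * _ + _)); apply: eq_bigr => i _; rewrite mxE ?mulrDl.
Qed.

Lemma weight_form_additive : ~~ (odd i1 (+) odd i2) -> {morph weight_form : x y / x + y}.
Proof.
by move=> /negPf odd12 x y; rewrite formD_polar polar_weight_form odd12 mul0r addr0.
Qed.

Lemma weight_form_nondegenerate :
  ~~ odd m -> odd i1 (+) odd i2 -> nondegenerate_polar weight_form.
Proof.
move=> m_even odd12 x x_neq0.
have [/existsP[v /eqP xv]|/existsPn polar_neq1] := boolP [exists v, polar weight_form x v == 1].
  by exists v.
have entryE k : x 0 k = \sum_i x 0 i.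
  have dot_unit : \sum_i x 0 i * ('e_k : 'rV_m) 0 i = x 0 k.
    under eq_bigr do rewrite mulrC.
    exact: (syndrome_unit (fun i => x 0 i : ('F_2)^o) k).
  have := polar_neq1 'e_k; rewrite polar_weight_form odd12 mul1r dot_unit.
  rewrite [X in _ * X]sum_odd_F2 -/(wt _) wt_unit mulr1.
  by case: (F2P (x 0 k)); case: (F2P (\sum_i x 0 i)).
case/eqP: x_neq0; apply/rowP => k; rewrite mxE entryE; under eq_bigr do rewrite entryE.
by rewrite sumr_const card_ord -mulr_natr natr_odd_F2 (negPf m_even) mulr0.
Qed.

End WeightModFour.

(** * The extended Hamming subcodes *)

Lemma check_columns_parity_check (k N : nat) (P : 'M['F_2]_(k, N)) :
  check_columns (parity_check_code P) (fun j => (col j P)^T).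
Proof.
move=> x; rewrite mem_parity_check_code -(inj_eq (@trmx_inj _ _ _)) trmx_mul trmxK trmx0.
by rewrite mulmx_sum_row /syndrome; under eq_bigr do rewrite -tr_col.
Qed.

Definition extend_columns (N : nat) (W : zmodType) (c : 'I_N -> W) (i : 'I_(1 + N)) : W :=
  if split i is inr j then c j else 0.

Lemma extend_columns_inj (N : nat) (W : zmodType) (c : 'I_N -> W) :
  injective c -> (forall j, c j != 0) -> injective (extend_columns c).
Proof.
move=> c_inj c_neq0 i j; rewrite /extend_columns -{2}[i]splitK -{2}[j]splitK.
case: (split i) => i'; case: (split j) => j' /=; first by rewrite !ord1.
- by move/esym/eqP; rewrite (negPf (c_neq0 j')).
- by move/eqP; rewrite (negPf (c_neq0 i')).
- by move/c_inj ->.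
Qed.

Lemma check_columns_extension (N : nat) (W : lmodType 'F_2)
    (C : {vspace 'rV['F_2]_N}) (c : 'I_N -> W) :
  check_columns C c ->
  check_columns (extension C) (fun i => (1, extend_columns c i) : ('F_2)^o * W).
Proof.
move=> memC z; set S := syndrome _ z; rewrite -[z]hsubmxK in S *.
move: (lsubmx z) (rsubmx z) @S => a x S.
have S1 : S.1 = a 0 0 + \sum_j x 0 j.
  rewrite (syndrome_morph (T := fst) (c' := fun=> 1 : ('F_2)^o)) //.
  rewrite /syndrome big_split_ord big_ord1 /= row_mxEl [_ *: _]mulr1; congr (_ + _).
  by apply: eq_bigr => j _; rewrite row_mxEr [_ *: _]mulr1.
have S2 : S.2 = syndrome c x.
  rewrite (syndrome_morph (T := snd) (c' := extend_columns c)) //.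
  rewrite /syndrome big_split_ord big_ord1 /= {1}/extend_columns (unsplitK (inl ord0)).
  rewrite scaler0 add0r.
  by apply: eq_bigr => j _; rewrite row_mxEr /extend_columns (unsplitK (inr j)).
rewrite [S]surjective_pairing xpair_eqE S1 S2 -memC (addr_eq0_F2 (V := ('F_2)^o)).
apply/mem_extensionP/andP => [[y yC /eq_row_mx[-> ->]]|[/eqP ax xC]].
  by rewrite mxE eqxx.
by exists x => //; congr row_mx; apply/matrixP=> i j; rewrite !ord1 ax mxE eqxx.
Qed.

Section HammingColumns.
Variables (m n : nat) (L : fieldExtType 'F_2) (alpha : L).
Hypothesis dimL : \dim {:L} = m.
Hypothesis prim_alpha : n.-primitive_root alpha.

Definition hamming_column (j : 'I_n) : 'rV['F_2]_m := (col j (hamming_mx alpha m n))^T.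

Lemma expr_power_basis_span j : alpha ^+ j \in <<power_basis alpha m>>%VS.
Proof.
have alpha_j : alpha ^+ j \in <<1; alpha>>%VS by rewrite rpredX // memv_adjoin.
have size_le : (size (Fadjoin_poly 1 alpha (alpha ^+ j)) <= m)%N.
  apply: leq_trans (size_Fadjoin_poly _ _ _) _.
  have := dim_Fadjoin 1%AS alpha; rewrite dimv1 muln1 -dimL => <-.
  exact: dimvS (subvf _).
rewrite -(Fadjoin_poly_eq alpha_j) horner_coef; apply: memv_suml => i _.
have /polyOverP/(_ i)/vlineP[a ->] := Fadjoin_polyOver 1 alpha (alpha ^+ j).
rewrite mulr_algl memvZ // memv_span //.
by apply/tnthP; exists (Ordinal (leq_trans (ltn_ord i) size_le)); rewrite tnth_mktuple.
Qed.

Lemma expr_hamming_column (j : 'I_n) : alpha ^+ j = \sum_i hamming_column j 0 i *: alpha ^+ i.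
Proof.
rewrite [LHS](coord_span (expr_power_basis_span j)); apply: eq_bigr => i _.
by rewrite !mxE nth_mktuple.
Qed.

Lemma hamming_column_neq0 j : hamming_column j != 0.
Proof.
apply/eqP=> col0; have := expr_hamming_column j.
rewrite col0 big1 => [/eqP|i _]; last by rewrite mxE scale0r.
apply/negP; rewrite expf_neq0 //; apply: contra_eqN (prim_expr_order prim_alpha).
by move=> /eqP ->; rewrite expr0n eqn0Ngt (prim_order_gt0 prim_alpha) eq_sym oner_eq0.
Qed.

Lemma hamming_column_inj : injective hamming_column.
Proof.
move=> i j e; apply: val_inj => /=.
have /eqP : alpha ^+ i = alpha ^+ j by rewrite !expr_hamming_column e.
by rewrite (eq_prim_root_expr prim_alpha) !modn_small // => /eqP.
Qed.

Definition extended_hamming_column := extend_columns hamming_column.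

Lemma extended_hamming_column_bij : n = (2 ^ m - 1)%N -> bijective extended_hamming_column.
Proof.
move=> nE; apply: inj_card_bij.
  exact: extend_columns_inj hamming_column_inj hamming_column_neq0.
by rewrite card_mx card_Fp // mul1n card_ord nE subnKC ?expn_gt0.
Qed.

Lemma check_columns_extended_code (i1 i2 : 'I_4) (f : 'rV['F_2]_m -> 'F_2) :
    f 0 = 0 -> (forall v, v != 0 -> f v = (weight_class i1 i2 (wt v))%:R) ->
  check_columns (extension (code_i1i2 alpha m n i1 i2))
    (graph_point f \o extended_hamming_column).
Proof.
move=> f0 fE; pose T (r : ('F_2)^o * 'rV['F_2]_(m + 1)) : synd 'rV['F_2]_m :=
  (r.1, lsubmx r.2, rsubmx r.2 0 0).
apply: (check_columns_inj (T := T)) (check_columns_extension (check_columns_parity_check _)).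
- by move=> [a u] [b v]; congr (_, _, _); [apply: (linearD lsubmx) | rewrite /= !mxE].
- move=> [a u] [b v] [-> uv_l uv_r]; congr (_, _).
  by rewrite -[u]hsubmxK -[v]hsubmxK uv_l; congr row_mx; apply/matrixP=> i j; rewrite !ord1.
- move=> i; rewrite /T /extended_hamming_column /extend_columns /graph_point /=.
  case: (split i) => [_|j].
    by rewrite f0; congr (_, _, _); rewrite ?linear0 ?mxE.
  rewrite col_col_mx tr_col_mx row_mxKl row_mxKr fE ?hamming_column_neq0 //.
  by congr (_, _, _); rewrite !mxE.
Qed.

End HammingColumns.

Lemma leq_dim_graph_code (m N : nat) (f : 'rV['F_2]_m -> 'F_2) (h : 'I_N -> 'rV['F_2]_m)
    (C : {vspace 'rV['F_2]_N}) :
    {morph f : u v / u + v} -> check_columns C (graph_point f \o h) ->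
  (N <= \dim C + (1 + m))%N.
Proof.
move=> fD memC; pose T (r : ('F_2)^o * 'rV['F_2]_m) : synd 'rV['F_2]_m :=
  (r.1, r.2, f r.2).
have TD : {morph T : r r' / r + r'} by move=> r r'; rewrite /T /= fD.
have -> : (1 + m)%N = dim (('F_2)^o * 'rV['F_2]_m)%type.
  by rewrite [RHS]/dim /= dim_matrix mul1r.
apply: (leq_dim_code (c := fun k => (1, h k) : ('F_2)^o * 'rV['F_2]_m)) => x Sx.
by rewrite memC -(syndrome_morph (T := T) (c := fun k => (1, h k)) _ TD) // Sx (morphD0 TD).
Qed.

Section ExtendedCode.
Variables (m n : nat) (L : fieldExtType 'F_2) (alpha : L) (i1 i2 : 'I_4).
Hypothesis dimL : \dim {:L} = m.
Hypothesis prim_alpha : n.-primitive_root alpha.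
Local Notation C := (extension (code_i1i2 alpha m n i1 i2)).
Local Notation h := (extended_hamming_column (n := n) m alpha).

Lemma weight_class0 : weight_class i1 i2 0 = (ord0 \in [set i1; i2]).
Proof. by rewrite !inE /weight_class !modn_small. Qed.

Lemma check_columns_weight_form : ord0 \notin [set i1; i2] ->
  check_columns C (graph_point (weight_form i1 i2) \o h).
Proof.
rewrite -weight_class0 => /negPf class0.
apply: check_columns_extended_code => // [|v _]; rewrite /weight_form class0.
  by rewrite wt0 class0.
by rewrite addbF.
Qed.

Lemma check_columns_punctured_weight_form : ord0 \in [set i1; i2] ->
  check_columns C (graph_point (fun v => weight_form i1 i2 v + (v != 0)%:R) \o h).
Proof.
rewrite -weight_class0 => class0.
apply: check_columns_extended_code => // [|v v_neq0]; rewrite /weight_form class0.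
  by rewrite wt0 class0 eqxx; apply/eqP.
by rewrite v_neq0 -natr_addb_F2 addbT addbT negbK.
Qed.

Lemma odd_classes_extended_code :
    (1 < m)%N -> n = (2 ^ m - 1)%N -> i1 != i2 -> ord0 \notin [set i1; i2] ->
  \dim C = (n - m - 1)%N -> odd i1 (+) odd i2.
Proof.
move=> m_gt1 nE neq_i12 notin0 dimC; apply: contraT => even12.
have := leq_dim_graph_code (weight_form_additive neq_i12 even12) (check_columns_weight_form notin0).
have : (2 ^ m = 2 * 2 ^ m.-1)%N by rewrite -expnS prednK // ltnW.
by have := ltn_expl m.-1 (isT : 1 < 2)%N; rewrite dimC; lia.
Qed.

End ExtendedCode.

Theorem theorem2p7 (m n : nat) (hm4 : (4 <= m)%N) (hm : ~~ odd m)
  (hn : n = (2 ^ m - 1)%N)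
  (L : fieldExtType 'F_2) (hL : \dim {:L} = m)
  (alpha : L) (halpha : n.-primitive_root alpha)
  (i1 i2 : 'I_4) (hi : i1 != i2)
  (hC : code_params (extension (code_i1i2 alpha m n i1 i2)) (n - m - 1)%N 4%N) :
  [/\ completely_transitive (extension (code_i1i2 alpha m n i1 i2)),
      covering_radius (extension (code_i1i2 alpha m n i1 i2)) = 4%N
    & is_intersection_array (extension (code_i1i2 alpha m n i1 i2))
        [:: (n + 1)%N; n; ((n + 1) %/ 2)%N; 1%N]
        [:: 1%N; ((n + 1) %/ 2)%N; n; (n + 1)%N]]
  <-> ord0 \notin [set i1; i2].
Proof.
have card_V : #|{: 'rV['F_2]_m}| = (n + 1)%N.
  by rewrite card_mx card_Fp // mul1n hn subnK ?expn_gt0.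
have V_gt15 : (15 < #|{: 'rV['F_2]_m}|)%N.
  by rewrite card_mx card_Fp // mul1n (leq_exp2l 4 m (isT : 1 < 2)%N).
have h_bij := extended_hamming_column_bij hL halpha hn.
have q_quad := weight_form_quadratic (m := m) hi.
have [in0 | notin0] := boolP (ord0 \in _); split=> //.
  have memC := check_columns_punctured_weight_form hL halpha in0.
  have [|x dx lower_neq] := card_lower_nbrs_punctured _ q_quad (fun=> erefl) h_bij memC.
    exact: leq_trans V_gt15.
  case=> _ rho4 [b [c [reg _]]]; rewrite rho4 => -[_ c2 _ _].
  by case/eqP: lower_neq; have [_ ->] := reg x; rewrite dx -c2 card_V divn2.
move=> _; have memC := check_columns_weight_form hL halpha notin0.
have [dimC _] := hC; have m_gt1 : (1 < m)%N by apply: leq_trans hm4.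
have odd12 := odd_classes_extended_code hL halpha m_gt1 hn hi notin0 dimC.
have q_nondeg := weight_form_nondegenerate hi hm odd12.
have V_gt1 : (1 < #|{: 'rV['F_2]_m}|)%N by apply: leq_trans V_gt15.
have trans_C := completely_transitive_bent V_gt1 q_quad q_nondeg h_bij memC.
have [rho4 array_C] := intersection_array_bent V_gt1 q_quad q_nondeg h_bij memC.
by split=> //; move: array_C; rewrite card_V -divn2 addn1.
Qed.
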